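(* The square of the element $\mathfrak{D}=x_au_a+\gamma\in\mathcal{W}_G=U(\mathfrak{g})\otimes\mathrm{Cl}(\mathfrak{g})$ is given by $$\mathfrak{D}^2=\tfrac12u_au_a+\gamma^2=\tfrac12u_au_a-\tfrac1{48}f_{abc}f_{abc}.$$
   Context: $G$ is a compact connected Lie group with Lie algebra $\mathfrak{g}$, equipped with an invariant inner product. $(e_a)$ is an orthonormal basis, $[e_a,e_b]=f_{abc}e_c$; repeated indices are summed. Everything is over $\mathbb{R}$. $U(\mathfrak{g})$ is the universal enveloping algebra, with generators $u_a$ corresponding to $e_a$ ($u_au_b-u_bu_a=f_{abc}u_c$). $\mathrm{Cl}(\mathfrak{g})$ is the Clifford algebra with generators $x_a$ and relations $x_ax_b+x_bx_a=\delta_{ab}$. In $\mathcal{W}_G$ write $u_a=u_a\otimes1$ and $x_a=1\otimes x_a$ (these commute with each other). $\gamma=-\frac16f_{abc}x_ax_bx_c\in\mathrm{Cl}(\mathfrak{g})$. *)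

(* Defs.v *)
From HB Require Import structures.
From mathcomp Require Import all_boot all_algebra.
From mathcomp Require Import boolp classical_sets reals.
From mathcomp Require Import finmap monalg.

Set Implicit Arguments.
Unset Strict Implicit.
Unset Printing Implicit Defensive.

Import GRing.Theory.

Local Open Scope ring_scope.
Local Open Scope classical_set_scope.
Local Open Scope quotient_scope.

Lemma malg_scalerAr (R : comNzRingType) (K : monomType) (a : R)
  (p q : {malg R[K]}) : a *: (p * q) = p * (a *: q).
Proof.
apply/malgP => k; rewrite mcoeffZ.
rewrite (mcoeffMlw _ (fsubset_refl (msupp p)) (msuppZ_le a q)) mcoeffMl.
rewrite mulr_sumr; apply: eq_bigr => i _; rewrite mulr_sumr.
by apply: eq_bigr => j _; rewrite mcoeffZ mulrnAr mulrCA.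
Qed.

(* Noncommutative polynomials: the monoid algebra of the free monoid on X. The
   product and the variables are locked only to keep unification fast. *)
Definition freealg (R : comNzRingType) (X : choiceType) : Type :=
  {malg R[{fmonom X}]}.
HB.instance Definition _ (R : comNzRingType) (X : choiceType) :=
  GRing.Lmodule.on (freealg R X).

HB.lock Definition freevar (R : comNzRingType) (X : choiceType) (x : X) :
  freealg R X := << fmu x >> : {malg R[{fmonom X}]}.
Arguments freevar {R X} x.

HB.lock Definition freealg_one (R : comNzRingType) (X : choiceType) :
  freealg R X := (1 : {malg R[{fmonom X}]}).

HB.lock Definition freealg_mul (R : comNzRingType) (X : choiceType)
    (p q : freealg R X) : freealg R X :=
  (p : {malg R[{fmonom X}]}) * (q : {malg R[{fmonom X}]}).

Section FreeAlgebra.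
Variables (R : comNzRingType) (X : choiceType).
Local Notation F := (freealg R X).
Local Notation one := (freealg_one R X).
Local Notation mul := (@freealg_mul R X).

Fact freealg_mulA : associative mul.
Proof. by move=> p q r; rewrite freealg_mul.unlock; exact: mulrA. Qed.

Fact freealg_mul1 : left_id one mul.
Proof.
by move=> p; rewrite freealg_mul.unlock freealg_one.unlock; exact: mul1r.
Qed.

Fact freealg_mulr1 : right_id one mul.
Proof.
by move=> p; rewrite freealg_mul.unlock freealg_one.unlock; exact: mulr1.
Qed.

Fact freealg_mulDl : left_distributive mul +%R.
Proof. by move=> p q r; rewrite freealg_mul.unlock; exact: mulrDl. Qed.

Fact freealg_mulDr : right_distributive mul +%R.
Proof. by move=> p q r; rewrite freealg_mul.unlock; exact: mulrDr. Qed.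

Fact freealg_one_neq0 : one != 0.
Proof. by rewrite freealg_one.unlock; exact: oner_neq0. Qed.

HB.instance Definition _ := GRing.Zmodule_isNzRing.Build F freealg_mulA
  freealg_mul1 freealg_mulr1 freealg_mulDl freealg_mulDr freealg_one_neq0.

Fact freealg_scalerAl (a : R) (p q : F) : a *: mul p q = mul (a *: p) q.
Proof. by rewrite freealg_mul.unlock; exact: fgscaleAl. Qed.

HB.instance Definition _ := GRing.Lmodule_isLalgebra.Build R F freealg_scalerAl.

Fact freealg_scalerAr (a : R) (p q : F) : a *: mul p q = mul p (a *: q).
Proof. by rewrite freealg_mul.unlock; exact: malg_scalerAr. Qed.

HB.instance Definition _ := GRing.Lalgebra_isAlgebra.Build R F freealg_scalerAr.

End FreeAlgebra.

Section TwoSidedIdeal.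
Variable A : pzRingType.
Implicit Types J S : set A.

Definition two_sided_ideal J :=
  [/\ J 0, forall x y, J x -> J y -> J (x - y),
      forall a x, J x -> J (a * x) & forall a x, J x -> J (x * a)].

Definition ideal_gen S : {pred A} :=
  fun x => `[< forall J, two_sided_ideal J -> S `<=` J -> J x >].

Variable S : set A.

Lemma ideal_gen_zmod_closed : zmod_closed (ideal_gen S).
Proof.
split=> [|x y /asboolP Sx /asboolP Sy]; apply/asboolP => J idJ SJ.
  by case: idJ.
by case: (idJ) => _ JB _ _; apply: JB; [exact: Sx|exact: Sy].
Qed.

HB.instance Definition _ :=
  GRing.isZmodClosed.Build A (ideal_gen S) ideal_gen_zmod_closed.

Lemma ideal_genMl a x : x \in ideal_gen S -> a * x \in ideal_gen S.
Proof.
move=> /asboolP Sx; apply/asboolP => J idJ SJ.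
by case: (idJ) => _ _ JMl _; apply: JMl; exact: Sx.
Qed.

Lemma ideal_genMr a x : x \in ideal_gen S -> x * a \in ideal_gen S.
Proof.
move=> /asboolP Sx; apply/asboolP => J idJ SJ.
by case: (idJ) => _ _ _; apply; exact: Sx.
Qed.

Lemma ideal_gen_sub x : S x -> x \in ideal_gen S.
Proof. by move=> Sx; apply/asboolP => J _; apply. Qed.

End TwoSidedIdeal.

(* The associative unital R-algebra with generators X and relations r = 0 for
   r in S. Nothing guarantees 1 != 0 for an arbitrary S, so this is a
   pzRingType with an lmodType structure and the compatibilities pres_scalerAl
   and pres_scalerAr; MathComp's algType would require 1 != 0. *)
Section Presented.
Variables (R : comNzRingType) (X : choiceType) (S : set (freealg R X)).

Definition presented := {ideal_quot (ideal_gen S)}.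

HB.instance Definition _ := GRing.Zmodule.on presented.
HB.instance Definition _ := EqQuotient.on presented.

End Presented.

HB.lock Definition pres_proj (R : comNzRingType) (X : choiceType)
  (S : set (freealg R X)) (p : freealg R X) : presented S := \pi p.

HB.lock Definition pres_mul (R : comNzRingType) (X : choiceType)
    (S : set (freealg R X)) (p q : presented S) : presented S :=
  pres_proj S (repr p * repr q).

HB.lock Definition pres_scale (R : comNzRingType) (X : choiceType)
    (S : set (freealg R X)) (a : R) (p : presented S) : presented S :=
  pres_proj S (a *: repr p).

Definition pres_gen (R : comNzRingType) (X : choiceType)
  (S : set (freealg R X)) (x : X) : presented S := pres_proj S (freevar x).

Section PresentedTheory.
Variables (R : comNzRingType) (X : choiceType) (S : set (freealg R X)).
Local Notation presented := (presented S).
Local Notation pres_proj := (pres_proj S).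
Local Notation pres_mul := (@pres_mul R X S).
Local Notation pres_scale := (@pres_scale R X S).

Lemma pres_projK (p : presented) : pres_proj (repr p) = p.
Proof. by rewrite pres_proj.unlock; exact: reprK. Qed.

Lemma pres_projP p q :
  (pres_proj p = pres_proj q) <-> (p - q \in ideal_gen S).
Proof.
by rewrite pres_proj.unlock Quotient.idealrBE; split=> [/eqP|/eqP].
Qed.

Lemma repr_pres_proj p : repr (pres_proj p) - p \in ideal_gen S.
Proof. by apply/pres_projP; rewrite pres_projK. Qed.

Lemma pres_projD p q : pres_proj (p + q) = pres_proj p + pres_proj q.
Proof. by rewrite pres_proj.unlock !piE. Qed.

Lemma pres_projM p q : pres_proj (p * q) = pres_mul (pres_proj p) (pres_proj q).
Proof.
rewrite pres_mul.unlock; apply/esym/pres_projP.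
set p' := repr _; set q' := repr _.
have -> : p' * q' - p * q = (p' - p) * q' + p * (q' - q).
  by rewrite mulrBl mulrBr addrA subrK.
by rewrite rpredD //; [apply/ideal_genMr|apply/ideal_genMl];
   exact: repr_pres_proj.
Qed.

Fact pres_proj_scalable a p :
  pres_proj (a *: p) = pres_scale a (pres_proj p).
Proof.
rewrite pres_scale.unlock; apply/esym/pres_projP; set p' := repr _.
have -> : a *: p' - a *: p = (a *: 1) * (p' - p).
  by rewrite -scalerAl mul1r scalerBr.
exact/ideal_genMl/repr_pres_proj.
Qed.

Lemma presW (P : presented -> Prop) :
  (forall p, P (pres_proj p)) -> forall p, P p.
Proof. by move=> Pp p; rewrite -(pres_projK p). Qed.

Fact pres_mulA : associative pres_mul.
Proof.
by elim/presW=> x; elim/presW=> y; elim/presW=> z; rewrite -!pres_projM mulrA.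
Qed.

Fact pres_mul1 : left_id (pres_proj 1) pres_mul.
Proof. by elim/presW=> x; rewrite -pres_projM mul1r. Qed.

Fact pres_mulr1 : right_id (pres_proj 1) pres_mul.
Proof. by elim/presW=> x; rewrite -pres_projM mulr1. Qed.

Fact pres_mulDl : left_distributive pres_mul +%R.
Proof.
elim/presW=> x; elim/presW=> y; elim/presW=> z.
by rewrite -pres_projD -!pres_projM -pres_projD mulrDl.
Qed.

Fact pres_mulDr : right_distributive pres_mul +%R.
Proof.
elim/presW=> x; elim/presW=> y; elim/presW=> z.
by rewrite -pres_projD -!pres_projM -pres_projD mulrDr.
Qed.

HB.instance Definition _ := GRing.Zmodule_isPzRing.Build presented
  pres_mulA pres_mul1 pres_mulr1 pres_mulDl pres_mulDr.

Fact pres_scaleA a b (x : presented) :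
  pres_scale a (pres_scale b x) = pres_scale (a * b) x.
Proof. by elim/presW: x => x; rewrite -!pres_proj_scalable scalerA. Qed.

Fact pres_scale1 : left_id 1 pres_scale.
Proof. by elim/presW=> x; rewrite -pres_proj_scalable scale1r. Qed.

Fact pres_scaleDr : right_distributive pres_scale +%R.
Proof.
move=> a; elim/presW=> x; elim/presW=> y.
by rewrite -pres_projD -!pres_proj_scalable -pres_projD scalerDr.
Qed.

Fact pres_scaleDl (x : presented) : {morph pres_scale^~ x : a b / a + b}.
Proof.
by move=> a b; elim/presW: x => x; rewrite -!pres_proj_scalable -pres_projD scalerDl.
Qed.

HB.instance Definition _ := GRing.Zmodule_isLmodule.Build R presented
  pres_scaleA pres_scale1 pres_scaleDr pres_scaleDl.

Fact pres_proj_zmod_morphism : zmod_morphism pres_proj.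
Proof. by move=> p q; rewrite pres_proj.unlock !piE. Qed.

HB.instance Definition _ := GRing.isZmodMorphism.Build (freealg R X) presented
  pres_proj pres_proj_zmod_morphism.

HB.instance Definition _ := GRing.isMonoidMorphism.Build (freealg R X) presented
  pres_proj (erefl, pres_projM).

HB.instance Definition _ := GRing.isScalable.Build R (freealg R X) presented
  *:%R pres_proj pres_proj_scalable.

Lemma pres_projZ a p : pres_proj (a *: p) = a *: pres_proj p.
Proof. exact: pres_proj_scalable. Qed.

Lemma pres_scalerAl a (x y : presented) : a *: (x * y) = (a *: x) * y.
Proof.
elim/presW: x => x; elim/presW: y => y.
by rewrite -rmorphM -!pres_projZ -rmorphM scalerAl.
Qed.

Lemma pres_scalerAr a (x y : presented) : a *: (x * y) = x * (a *: y).
Proof.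
elim/presW: x => x; elim/presW: y => y.
by rewrite -rmorphM -!pres_projZ -rmorphM scalerAr.
Qed.

Lemma pres_rel p q : S (p - q) -> pres_proj p = pres_proj q.
Proof. by move=> Spq; apply/pres_projP; exact: ideal_gen_sub. Qed.

Lemma pres_gen_linear (V : lmodType R) (h : V -> X) :
  (forall k x y,
     S (freevar (h (k *: x + y)) - (k *: freevar (h x) + freevar (h y)))) ->
  linear (fun x => pres_gen S (h x)).
Proof.
move=> Sh k x y; rewrite /pres_gen (pres_rel (Sh k x y)) rmorphD.
by rewrite /= pres_projZ.
Qed.

End PresentedTheory.

(* The tensor product of two R-algebras A and B, for A and B given as quotients
   of free algebras: symbols a (x) b subject to bilinearity, with unit
   1 (x) 1 and product (a (x) b) (a' (x) b') = a a' (x) b b'. The last two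
   relations make every element a linear combination of symbols. *)
Section TensorAlgebra.
Variables (R : comNzRingType) (X Y : choiceType).
Variables (S : set (freealg R X)) (T : set (freealg R Y)).
Let A := presented S.
Let B := presented T.

Variant tensor_rel : set (freealg R (A * B)%type) :=
| TensorLinearl (k : R) (a a' : A) (b : B) :
    tensor_rel (freevar (k *: a + a', b)
                - (k *: freevar (a, b) + freevar (a', b)))
| TensorLinearr (k : R) (a : A) (b b' : B) :
    tensor_rel (freevar (a, k *: b + b')
                - (k *: freevar (a, b) + freevar (a, b')))
| TensorOne : tensor_rel (freevar (1, 1) - 1)
| TensorMul (a a' : A) (b b' : B) :
    tensor_rel (freevar (a, b) * freevar (a', b')
                - freevar (a * a', b * b')).

Definition tensor_alg := presented tensor_rel.
HB.instance Definition _ := GRing.PzRing.on tensor_alg.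
HB.instance Definition _ := GRing.Lmodule.on tensor_alg.

Definition tens (a : A) (b : B) : tensor_alg := pres_gen tensor_rel (a, b).

Lemma tens_linearl b : linear (tens^~ b).
Proof. exact: (pres_gen_linear (fun k a a' => TensorLinearl k a a' b)). Qed.

Lemma tens_linearr a : linear (tens a).
Proof. exact: (pres_gen_linear (fun k b b' => TensorLinearr k a b b')). Qed.

Lemma tens1 : tens 1 1 = 1.
Proof. by rewrite /tens /pres_gen (pres_rel TensorOne). Qed.

Lemma tensM a a' b b' : tens a b * tens a' b' = tens (a * a') (b * b').
Proof.
by rewrite /tens /pres_gen -(pres_rel (TensorMul a a' b b')) rmorphM.
Qed.

End TensorAlgebra.

HB.mixin Record isLieAlgebra (R : nzRingType) g of Vector R g := {
  lie : g -> g -> g;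
  lie_linearl : forall y, linear (lie^~ y);
  lie_linearr : forall x, linear (lie x);
  liexx : forall x, lie x x = 0;
  lie_jacobi : forall x y z,
    lie x (lie y z) + lie y (lie z x) + lie z (lie x y) = 0
}.

#[short(type="lieAlgType")]
HB.structure Definition LieAlgebra (R : nzRingType) :=
  {g of Vector R g & isLieAlgebra R g}.

(* Infinitesimal invariance: ad x is skew-adjoint for every x. For the Lie
   algebra of a connected Lie group this is equivalent to Ad-invariance. *)
Definition lie_invariant (R : nzRingType) (g : lieAlgType R)
    (ip : g -> g -> R) :=
  forall x y z : g, ip (lie x y) z + ip y (lie x z) = 0.

Section EnvelopingAlgebra.
Variables (R : comNzRingType) (g : lieAlgType R).

(* The quotient of the tensor algebra T(g) (the free algebra on the set g
   modulo linearity of the inclusion of g) by xy - yx = [x, y]. *)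
Variant enveloping_rel : set (freealg R g) :=
| EnvelopingLinear (k : R) (x y : g) :
    enveloping_rel (freevar (k *: x + y) - (k *: freevar x + freevar y))
| EnvelopingLie (x y : g) :
    enveloping_rel (freevar x * freevar y - freevar y * freevar x
                    - freevar (lie x y)).

Definition enveloping := presented enveloping_rel.
HB.instance Definition _ := GRing.PzRing.on enveloping.
HB.instance Definition _ := GRing.Lmodule.on enveloping.

Definition enveloping_gen (x : g) : enveloping := pres_gen enveloping_rel x.

Lemma enveloping_gen_linear : linear enveloping_gen.
Proof. exact: (pres_gen_linear EnvelopingLinear). Qed.

Lemma enveloping_gen_lie x y :
  enveloping_gen x * enveloping_gen y - enveloping_gen y * enveloping_gen x
  = enveloping_gen (lie x y).
Proof.
by rewrite /enveloping_gen /pres_gen -(pres_rel (EnvelopingLie x y)) rmorphB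
  !rmorphM.
Qed.

End EnvelopingAlgebra.

Section CliffordAlgebra.
Variables (R : comNzRingType) (V : lmodType R) (ip : V -> V -> R).

(* The convention is xy + yx = <x, y>, without a factor 2. *)
Variant clifford_rel : set (freealg R V) :=
| CliffordLinear (k : R) (x y : V) :
    clifford_rel (freevar (k *: x + y) - (k *: freevar x + freevar y))
| CliffordAnticomm (x y : V) :
    clifford_rel (freevar x * freevar y + freevar y * freevar x
                  - ip x y *: (1 : freealg R V)).

Definition clifford := presented clifford_rel.
HB.instance Definition _ := GRing.PzRing.on clifford.
HB.instance Definition _ := GRing.Lmodule.on clifford.

Definition clifford_gen (x : V) : clifford := pres_gen clifford_rel x.

Lemma clifford_gen_linear : linear clifford_gen.
Proof. exact: (pres_gen_linear CliffordLinear). Qed.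

Lemma clifford_gen_anticomm x y :
  clifford_gen x * clifford_gen y + clifford_gen y * clifford_gen x
  = ip x y *: (1 : clifford).
Proof.
have := pres_rel (CliffordAnticomm x y).
by rewrite rmorphD !rmorphM /= pres_projZ rmorph1.
Qed.

End CliffordAlgebra.

Section WeilAlgebra.
Variables (R : comNzRingType) (g : lieAlgType R) (ip : g -> g -> R).

Definition weil := tensor_alg (@enveloping_rel R g) (clifford_rel ip).
HB.instance Definition _ := GRing.PzRing.on weil.
HB.instance Definition _ := GRing.Lmodule.on weil.

Definition weil_U (a : enveloping g) : weil := tens a (1 : clifford ip).
Definition weil_Cl (b : clifford ip) : weil := tens (1 : enveloping g) b.

End WeilAlgebra.

Definition clifford_gamma (R : fieldType) (g : lieAlgType R)
    (ip : g -> g -> R) (n : nat) (e : n.-tuple g)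
    (f : 'I_n -> 'I_n -> 'I_n -> R) : clifford ip :=
  let x a := clifford_gen ip (tnth e a) in
  - (6%:R^-1 *: \sum_a \sum_b \sum_c f a b c *: (x a * x b * x c)).

Definition weil_dirac (R : fieldType) (g : lieAlgType R)
    (ip : g -> g -> R) (n : nat) (e : n.-tuple g)
    (f : 'I_n -> 'I_n -> 'I_n -> R) : weil ip :=
  \sum_a weil_Cl (clifford_gen ip (tnth e a))
         * weil_U ip (enveloping_gen (tnth e a))
  + weil_Cl (clifford_gamma ip e f).

(* Main.v *)
(* Put t = f_abc x_a x_b x_c and q_c = f_abc x_a x_b, so that gamma = - t / 6
   and t = q_c x_c. The Clifford relations give x_c t + t x_c = 3 q_c. In the
   square of x_a u_a, the antisymmetric part of x_a x_b pairs with [u_a, u_b]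
   to give q_c u_c / 2, which the cross terms x_c u_c gamma + gamma x_c u_c
   cancel. By the Jacobi identity q_c commutes with t, so
   t^2 = q_c x_c t = q_c (3 q_c - t x_c) = 3 q_c q_c - t^2; the Jacobi identity
   also removes the quartic part of q_c q_c, leaving
   q_c q_c = - f_abc f_abc / 2. *)

Require Import Defs.
From HB Require Import structures.
From mathcomp Require Import all_boot all_algebra.
From mathcomp Require Import boolp classical_sets reals ring.

Set Implicit Arguments.
Unset Strict Implicit.
Unset Printing Implicit Defensive.

Import GRing.Theory Num.Theory.

Local Open Scope ring_scope.

(** * Finite sums: Kronecker deltas and cyclic renaming of indices *)

Lemma sum_delta (R : pzRingType) (V : lmodType R) (n : nat) (a : 'I_n)
  (F : 'I_n -> V) : \sum_b (a == b)%:R *: F b = F a.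
Proof.
rewrite (bigD1 a) //= eqxx scale1r big1 ?addr0 // => b ne_ba.
by rewrite eq_sym (negbTE ne_ba) scale0r.
Qed.

Lemma sum3_rot (V : nmodType) (n : nat) (F : 'I_n -> 'I_n -> 'I_n -> V) :
  \sum_a \sum_b \sum_c F a b c = \sum_a \sum_b \sum_c F b c a.
Proof.
under eq_bigr do rewrite exchange_big.
by rewrite exchange_big; apply: eq_bigr => d _; rewrite exchange_big.
Qed.

(** * Identities for words in Clifford generators *)

Section CubicElement.
Variables (R : numFieldType) (X : choiceType) (S : set (freealg R X)).
Local Notation A := (presented S).
Variables (n : nat) (x : 'I_n -> A).
Hypothesis x_anticomm : forall a b,
  x a * x b + x b * x a = (a == b)%:R *: (1 : A).

Lemma anticomm_mull a b y : (x a * x b + x b * x a) * y = (a == b)%:R *: y.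
Proof. by rewrite x_anticomm -pres_scalerAl mul1r. Qed.

Lemma anticomm_mulr a b y : y * (x a * x b + x b * x a) = (a == b)%:R *: y.
Proof. by rewrite x_anticomm -pres_scalerAr mulr1. Qed.

(** Expand [x a * {x b, x d} - {x a, x d} * x b], braces denoting anticommutators: the words
    [x a * x d * x b] cancel. *)
Lemma clifford_comm2 a b d :
  x a * x b * x d - x d * (x a * x b)
  = (b == d)%:R *: x a - (a == d)%:R *: x b.
Proof.
rewrite -(anticomm_mull a d) -(anticomm_mulr b d) mulrDr mulrDl !mulrA.
by rewrite opprD addrA addrK.
Qed.

(** Moving [x c] through the three factors costs one anticommutator per factor, with alternating
    signs; the intermediate quartic words telescope. *)
Lemma clifford_anticomm3 c a b d :
  x c * (x a * x b * x d) + x a * x b * x d * x c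
  = (c == a)%:R *: (x b * x d) - (c == b)%:R *: (x a * x d)
    + (c == d)%:R *: (x a * x b).
Proof.
have -> : (c == b)%:R *: (x a * x d) = x a * (x c * x b + x b * x c) * x d.
  by rewrite anticomm_mulr pres_scalerAl.
rewrite -(anticomm_mull c a) -(anticomm_mulr c d) !mulrDr !mulrDl !mulrA.
by rewrite opprD !addrA addrK subrK.
Qed.

Lemma clifford_rotl a b d :
  x b * x d * x a
  = x a * x b * x d + (a == d)%:R *: x b - (a == b)%:R *: x d.
Proof.
rewrite -(anticomm_mulr a d) -(anticomm_mull a b) mulrDr mulrDl !mulrA.
by rewrite addrA [_ + _ - _]addrAC subrr add0r.
Qed.

Lemma clifford_rotr a b d :
  x d * x a * x b
  = x a * x b * x d + (a == d)%:R *: x b - (b == d)%:R *: x a.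
Proof.
rewrite -(anticomm_mull a d) -(anticomm_mulr b d) mulrDr mulrDl !mulrA.
by rewrite addrA [_ + _ - _]addrAC subrr add0r.
Qed.

(** Adding the sum to its copy with [a] and [b] exchanged turns every product into an
    anticommutator, so only the trace of [K] survives. *)
Lemma sum_clifford_sym (K : 'I_n -> 'I_n -> R) :
  (forall a b, K a b = K b a) ->
  \sum_a \sum_b K a b *: (x a * x b) = (2%:R^-1 * \sum_a K a a) *: (1 : A).
Proof.
move=> Ksym; rewrite -scalerA; set s := \sum_a \sum_b _.
suff <-: s + s = (\sum_a K a a) *: (1 : A).
  by rewrite -mulr2n -scaler_nat scalerA mulVf ?scale1r ?pnatr_eq0.
rewrite {2}/s exchange_big /s -big_split scaler_suml /=.
apply: eq_bigr => a _; rewrite -(sum_delta a (fun b => K a b *: (1 : A))).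
rewrite -big_split /=; apply: eq_bigr => b _.
by rewrite [K b a]Ksym -scalerDr x_anticomm !scalerA mulrC.
Qed.

(* Rotating a cubic monomial cyclically changes it by linear terms only, so
   averaging over rotations kills the cubic part. *)
Lemma sum_clifford_jacobi (h : 'I_n -> 'I_n -> 'I_n -> R) :
  (forall a b d, h a b d = - h b a d) ->
  (forall a b d, h a b d + h b d a + h d a b = 0) ->
  \sum_a \sum_b \sum_d h a b d *: (x a * x b * x d)
  = - \sum_a \sum_b h a b a *: x b.
Proof.
move=> h_antisym h_cyclic; set s := \sum_a _; set l := \sum_a _.
have rotl : s = \sum_a \sum_b \sum_d h b d a *: (x b * x d * x a).
  by rewrite /s sum3_rot.
have rotr : s = \sum_a \sum_b \sum_d h d a b *: (x d * x a * x b).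
  by rewrite rotl sum3_rot.
(* Here [m] is the cubic monomial; its coefficients in the three rotations add up to zero by
   [h_cyclic], which leaves the linear corrections [p], [r], [v]. *)
have scale_cancel k1 k2 k3 (m p r v : A) : k1 + k2 + k3 = 0 ->
    k1 *: m + (k2 *: (m + p - r) + k3 *: (m + p - v))
    = - (k1 *: p) - k2 *: r - k3 *: v.
  rewrite -addrA => /eqP; rewrite addr_eq0 => /eqP->.
  rewrite -!addrA !scalerDr !scalerN [X in _ + X = _]addrACA -scalerDl.
  by rewrite scaleNr addKr addrACA -scalerDl scaleNr opprK.
have s3 : s + (s + s) = - l - l - l.
  rewrite {2}rotl {2}rotr {1}/s -!big_split /=.
  transitivity (\sum_a \sum_b \sum_d
      (- (h a b d *: ((a == d)%:R *: x b)) - h b d a *: ((a == b)%:R *: x d)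
       - h d a b *: ((b == d)%:R *: x a))).
    apply: eq_bigr => a _; rewrite -!big_split /=; apply: eq_bigr => b _.
    rewrite -!big_split /=; apply: eq_bigr => d _.
    by rewrite (clifford_rotl a b d) (clifford_rotr a b d) scale_cancel.
  have -> : - l - l - l = \sum_a \sum_b \sum_d
        - (h a b d *: ((a == d)%:R *: x b))
      - \sum_a \sum_d \sum_b h b d a *: ((a == b)%:R *: x d)
      - \sum_a \sum_b \sum_d h d a b *: ((b == d)%:R *: x a).
    (* In each group the delta identifies the first and third arguments of [h], so each contributes
       [- l] after renaming. *)
    congr (_ - _ - _).
    - rewrite -sumrN; apply: eq_bigr => a _; rewrite -sumrN.
      apply: eq_bigr => b _; rewrite sumrN; congr (- _).
      rewrite -(sum_delta a (fun d => h a b d *: x b)).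
      by apply: eq_bigr => d _; rewrite !scalerA mulrC.
    - apply: eq_bigr => a _; apply: eq_bigr => d _.
      rewrite -(sum_delta a (fun b => h b d a *: x d)).
      by apply: eq_bigr => b _; rewrite !scalerA mulrC.
    - rewrite /l exchange_big; apply: eq_bigr => a _; apply: eq_bigr => b _.
      rewrite -(sum_delta b (fun d => h d a b *: x a)).
      by apply: eq_bigr => d _; rewrite !scalerA mulrC.
  rewrite -!sumrB; apply: eq_bigr => a _; rewrite [X in _ - X - _]exchange_big.
  rewrite -!sumrB; apply: eq_bigr => b _.
  by rewrite -!sumrB.
apply: (@scalerI _ _ 3%:R); first by rewrite pnatr_eq0.
by rewrite !scaler_nat !mulrS !mulr0n !addr0 s3 addrA.
Qed.

(** * The cubic element [t] and its quadratic contractions [q c] *)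

Variable f : 'I_n -> 'I_n -> 'I_n -> R.
Hypothesis f_antisym12 : forall a b c, f a b c = - f b a c.
Hypothesis f_antisym23 : forall a b c, f a b c = - f a c b.

Let q c := \sum_a \sum_b f a b c *: (x a * x b).
Let t := \sum_a \sum_b \sum_c f a b c *: (x a * x b * x c).

Lemma f_cyclic a b c : f a b c = f b c a.
Proof. by rewrite f_antisym12 f_antisym23 opprK. Qed.

Lemma cubic_quadratic : t = \sum_c q c * x c.
Proof.
rewrite /t; under eq_bigr do rewrite exchange_big.
rewrite exchange_big /=; apply: eq_bigr => c _.
rewrite mulr_suml; apply: eq_bigr => a _.
by rewrite mulr_suml; apply: eq_bigr => b _; rewrite pres_scalerAl.
Qed.

(** Each of the three contractions in [clifford_anticomm3] yields one [q c]: the first by cyclicity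
    of [f], the second because antisymmetry in the last two indices absorbs its minus sign, the
    third directly. *)
Lemma cubic_anticomm c : x c * t + t * x c = 3%:R *: q c.
Proof.
transitivity (\sum_a \sum_b \sum_d (f a b d *: ((c == a)%:R *: (x b * x d))
    - f a b d *: ((c == b)%:R *: (x a * x d))
    + f a b d *: ((c == d)%:R *: (x a * x b)))).
  rewrite /t mulr_sumr mulr_suml -big_split; apply: eq_bigr => a _ /=.
  rewrite mulr_sumr mulr_suml -big_split; apply: eq_bigr => b _ /=.
  rewrite mulr_sumr mulr_suml -big_split; apply: eq_bigr => d _ /=.
  rewrite -pres_scalerAr -pres_scalerAl -scalerDr clifford_anticomm3.
  by rewrite scalerDr scalerBr.
have -> : 3%:R *: q c =
    \sum_b \sum_d \sum_a f a b d *: ((c == a)%:R *: (x b * x d))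
    - \sum_a \sum_d \sum_b f a b d *: ((c == b)%:R *: (x a * x d))
    + \sum_a \sum_b \sum_d f a b d *: ((c == d)%:R *: (x a * x b)).
  rewrite scaler_nat !mulrS mulr0n addr0 addrA; congr (_ + _ + _).
  - apply: eq_bigr => b _; apply: eq_bigr => d _; rewrite -f_cyclic.
    rewrite -(sum_delta c (fun a => f a b d *: (x b * x d))).
    by apply: eq_bigr => a _; rewrite !scalerA mulrC.
  - rewrite -sumrN; apply: eq_bigr => a _; rewrite -sumrN.
    apply: eq_bigr => d _; rewrite f_antisym23 scaleNr; congr (- _).
    rewrite -(sum_delta c (fun b => f a b d *: (x a * x d))).
    by apply: eq_bigr => b _; rewrite !scalerA mulrC.
  - apply: eq_bigr => a _; apply: eq_bigr => b _.
    rewrite -(sum_delta c (fun d => f a b d *: (x a * x b))).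
    by apply: eq_bigr => d _; rewrite !scalerA mulrC.
rewrite [in RHS]sum3_rot -sumrB -big_split; apply: eq_bigr => a _ /=.
rewrite [X in _ = _ - X + _]exchange_big -sumrB -big_split.
by apply: eq_bigr => b _ /=; rewrite -sumrB -big_split.
Qed.

(** For structure constants [f] of a Lie algebra, this makes the commutator with [- q c / 2] act on
    the generators as the adjoint action of the basis vector of index [c]. *)
Lemma quadratic_comm c d :
  q c * x d - x d * q c = 2%:R *: \sum_a f c a d *: x a.
Proof.
transitivity (\sum_a \sum_b (f a b c *: ((b == d)%:R *: x a)
                              - f a b c *: ((a == d)%:R *: x b))).
  rewrite /q mulr_sumr mulr_suml -sumrB; apply: eq_bigr => a _ /=.
  rewrite mulr_sumr mulr_suml -sumrB; apply: eq_bigr => b _ /=.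
  rewrite -pres_scalerAr -pres_scalerAl -scalerBr clifford_comm2.
  by rewrite scalerBr.
rewrite scaler_nat mulr2n; under eq_bigr do rewrite sumrB.
rewrite sumrB [X in _ - X]exchange_big /= -sumrN; congr (_ + _).
  apply: eq_bigr => a _; rewrite f_cyclic.
  rewrite -(sum_delta d (fun b => f a b c *: x a)).
  by apply: eq_bigr => b _; rewrite !scalerA eq_sym mulrC.
apply: eq_bigr => b _; rewrite f_cyclic f_antisym12 scaleNr; congr (- _).
rewrite -(sum_delta d (fun a => f a b c *: x b)).
by apply: eq_bigr => a _; rewrite !scalerA eq_sym mulrC.
Qed.

(** * Consequences of the Jacobi identity, up to the square of [t] *)

Hypothesis f_jacobi : forall a b d e,
  \sum_c f a b c * f d e c + \sum_c f b d c * f a e c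
  + \sum_c f d a c * f b e c = 0.

(** For structure constants this is minus the Killing form in the chosen basis, by antisymmetry of
    [f]. *)
Let K a b := \sum_c \sum_d f c a d * f c b d.

(** The left side is cubic with coefficients [h a b d], whose cyclic sum vanishes by Jacobi. Hence
    [sum_clifford_jacobi] leaves only the contraction of the first and third indices of [h], which
    is [K]. *)
Lemma sum_quadratic_contract e :
  \sum_c q c * (\sum_d f d e c *: x d) = - \sum_b K b e *: x b.
Proof.
pose h a b d := \sum_c f a b c * f d e c.
transitivity (\sum_a \sum_b \sum_d h a b d *: (x a * x b * x d)).
  under eq_bigr do rewrite mulr_suml.
  rewrite exchange_big; apply: eq_bigr => a _ /=.
  under eq_bigr do rewrite mulr_suml.
  rewrite exchange_big; apply: eq_bigr => b _ /=.
  under eq_bigr do rewrite mulr_sumr.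
  rewrite exchange_big; apply: eq_bigr => d _ /=.
  rewrite scaler_suml; apply: eq_bigr => c _.
  by rewrite -pres_scalerAr -pres_scalerAl scalerA mulrC.
rewrite sum_clifford_jacobi.
- rewrite exchange_big; congr (- _); apply: eq_bigr => b _.
  by rewrite -scaler_suml.
- move=> a b d; rewrite -sumrN; apply: eq_bigr => c _.
  by rewrite f_antisym12 mulNr.
- by move=> a b d; apply: f_jacobi.
Qed.

(** Passing [t] through [x a * x b] by [cubic_anticomm] reduces the commutator to a multiple of the
    sum of [y a * q a + q a * y a]. Reordering by [quadratic_comm] turns this into twice the
    difference of two linear expressions, both equal to [- \sum_b K b c *: x b]. *)
Lemma quadratic_cubic_comm c : q c * t = t * q c.
Proof.
pose y a := \sum_d f d c a *: x d.
have comm_pair a b : x a * x b * t - t * (x a * x b)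
    = 3%:R *: (x a * q b - q a * x b).
  rewrite scalerBr [X in _ = X - _]pres_scalerAr [X in _ = _ - X]pres_scalerAl.
  by rewrite -!cubic_anticomm mulrDr mulrDl !mulrA opprD addrA addrK.
apply/eqP; rewrite -subr_eq0; apply/eqP.
transitivity (- (3%:R *: \sum_a (y a * q a + q a * y a))).
  transitivity (3%:R *: \sum_a \sum_b f a b c *: (x a * q b - q a * x b)).
    rewrite {1 2}/q [_ * t]mulr_suml [t * _]mulr_sumr -sumrB scaler_sumr.
    apply: eq_bigr => a _.
    rewrite [_ * t]mulr_suml [t * _]mulr_sumr -sumrB scaler_sumr.
    apply: eq_bigr => b _; rewrite -pres_scalerAl -pres_scalerAr -scalerBr.
    by rewrite comm_pair !scalerA mulrC.
  rewrite -scalerN; congr (_ *: _); rewrite big_split opprD /=.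
  transitivity (\sum_a \sum_b f a b c *: (x a * q b)
      - \sum_a \sum_b f a b c *: (q a * x b)).
    rewrite -sumrB; apply: eq_bigr => a _; rewrite -sumrB.
    by apply: eq_bigr => b _; rewrite scalerBr.
  congr (_ + _); last first.
    congr (- _); apply: eq_bigr => a _; rewrite mulr_sumr.
    by apply: eq_bigr => b _; rewrite -pres_scalerAr f_cyclic.
  rewrite exchange_big -sumrN; apply: eq_bigr => a _; rewrite mulr_suml -sumrN.
  apply: eq_bigr => b _; rewrite -pres_scalerAl -scaleNr; congr (_ *: _).
  by rewrite f_cyclic f_antisym23 f_cyclic.
suff -> : \sum_a (y a * q a + q a * y a) = 0 by rewrite scaler0 oppr0.
have yq a : y a * q a
    = q a * y a - 2%:R *: \sum_d \sum_b (f d c a * f a b d) *: x b.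
  rewrite mulr_suml mulr_sumr scaler_sumr -sumrB; apply: eq_bigr => d _.
  rewrite -pres_scalerAl -pres_scalerAr -[x d * q a](subKr (q a * x d)).
  rewrite quadratic_comm scalerBr !scalerA mulrC -scalerA.
  by congr (_ - _ *: _); rewrite scaler_sumr; apply: eq_bigr => b _;
    rewrite scalerA.
(* The correction from reordering is again a contraction of two [f], with the same value that
   [sum_quadratic_contract] gives for the sum of [q a * y a]. *)
have contract : \sum_a \sum_d \sum_b (f d c a * f a b d) *: x b
    = - \sum_b K b c *: x b.
  rewrite -sumrN; under eq_bigr do rewrite exchange_big.
  rewrite exchange_big; apply: eq_bigr => b _ /=.
  rewrite exchange_big scaler_suml -sumrN; apply: eq_bigr => d _.
  rewrite scaler_suml -sumrN; apply: eq_bigr => a _.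
  by rewrite -scaleNr [f a b d]f_cyclic [f b d a]f_antisym12 mulrN mulrC.

under eq_bigr do rewrite yq addrAC -mulr2n -scaler_nat -scalerBr.
rewrite -scaler_sumr sumrB sum_quadratic_contract.
by rewrite contract subrr scaler0.
Qed.

(** Expanding only the second [q c] and summing over [c] first leaves a quadratic form with the
    symmetric matrix [- K]; [sum_clifford_sym] then gives half its trace. *)
Lemma sum_quadratic_sqr :
  \sum_c q c * q c
  = - (2%:R^-1 * \sum_a \sum_b \sum_c f a b c * f a b c) *: (1 : A).
Proof.
transitivity (\sum_e (\sum_c q c * (\sum_d f d e c *: x d)) * x e).
  under [RHS]eq_bigr do rewrite mulr_suml.
  rewrite exchange_big; apply: eq_bigr => c _ /=.
  under [RHS]eq_bigr do rewrite -mulrA.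
  rewrite -mulr_sumr {2}/q exchange_big; congr (_ * _).
  apply: eq_bigr => e _; rewrite mulr_suml.
  by apply: eq_bigr => d _; rewrite pres_scalerAl.
under eq_bigr do rewrite sum_quadratic_contract mulNr.
rewrite sumrN scaleNr; congr (- _).
transitivity (\sum_a \sum_b K a b *: (x a * x b)).
  rewrite exchange_big; apply: eq_bigr => e _ /=.
  by rewrite mulr_suml; apply: eq_bigr => b _; rewrite pres_scalerAl.
rewrite sum_clifford_sym.
  by rewrite exchange_big.
by move=> a b; apply: eq_bigr => c _; apply: eq_bigr => d _; exact: mulrC.
Qed.

Lemma cubic_sqr :
  t * t = - ((3%:R / 4%:R) * \sum_a \sum_b \sum_c f a b c * f a b c) *: (1 : A).
Proof.
have t2 : t * t = 3%:R *: (\sum_c q c * q c) - t * t.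
  rewrite {1 4}cubic_quadratic mulr_suml mulr_sumr scaler_sumr -sumrB.
  apply: eq_bigr => c _; rewrite -mulrA [t * _]mulrA -quadratic_cubic_comm.
  rewrite pres_scalerAr -cubic_anticomm -mulrA -mulrBr; congr (_ * _).
  by rewrite addrK.
(* Now [2 t^2] is three times the sum of [q c * q c], whence the constant 3/4 = (3/2)(1/2). *)
apply: (@scalerI _ _ 2%:R); first by rewrite pnatr_eq0.
rewrite scaler_nat mulr2n {1}t2 subrK sum_quadratic_sqr !scalerA.
congr (_ *: _); rewrite !mulrN !mulrA; congr (- (_ * _)).
by field.
Qed.

(** * Adding the enveloping generators: the square of the Dirac element *)

Variable u : 'I_n -> A.
Hypothesis xu_comm : forall a b, x a * u b = u b * x a.
Hypothesis u_lie : forall a b, u a * u b - u b * u a = \sum_c f a b c *: u c.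

(** Double the sum by exchanging [a] and [b], and split each pair of terms as [{x a, x b} * (u b * u
    a) + x a * x b * [u a, u b]]. The deltas of the first part give the Casimir term, the bracket of
    the second gives [q c * u c]. *)
Lemma sum_xu_sqr : (\sum_a x a * u a) * (\sum_a x a * u a)
  = 2%:R^-1 *: (\sum_a u a * u a) + 2%:R^-1 *: \sum_c q c * u c.
Proof.
set s := _ * _.
have sE : s = \sum_a \sum_b x a * x b * (u a * u b).
  rewrite /s mulr_suml; apply: eq_bigr => a _; rewrite mulr_sumr.
  apply: eq_bigr => b _; rewrite -mulrA [u a * _]mulrA -xu_comm.
  by rewrite !mulrA.
apply: (@scalerI _ _ 2%:R); first by rewrite pnatr_eq0.
rewrite -scalerDr scalerA mulfV ?pnatr_eq0 // scale1r scaler_nat mulr2n.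
rewrite {2}sE exchange_big sE -big_split.
transitivity (\sum_a (\sum_b (a == b)%:R *: (u b * u a)
    + \sum_b \sum_c f a b c *: (x a * x b * u c))).
  apply: eq_bigr => a _; rewrite -!big_split; apply: eq_bigr => b _ /=.
  have -> : \sum_c f a b c *: (x a * x b * u c)
      = x a * x b * (u a * u b) - x a * x b * (u b * u a).
    rewrite -mulrBr u_lie mulr_sumr.
    by apply: eq_bigr => c _; rewrite pres_scalerAr.
  by rewrite -anticomm_mull mulrDl [RHS]addrC addrA subrK.
rewrite big_split; congr (_ + _).
  by apply: eq_bigr => a _; rewrite (sum_delta a (fun b => u b * u a)).
under eq_bigr do rewrite exchange_big; rewrite exchange_big.
apply: eq_bigr => c _; rewrite mulr_suml; apply: eq_bigr => a _.
by rewrite mulr_suml; apply: eq_bigr => b _; rewrite pres_scalerAl.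
Qed.

Lemma cubic_u_comm c : t * u c = u c * t.
Proof.
rewrite mulr_suml mulr_sumr; apply: eq_bigr => a _.
rewrite mulr_suml mulr_sumr; apply: eq_bigr => b _.
rewrite mulr_suml mulr_sumr; apply: eq_bigr => d _.
rewrite -pres_scalerAl -pres_scalerAr; congr (_ *: _).
rewrite -[LHS]mulrA xu_comm mulrA -[x a * x b * u c]mulrA xu_comm.
by rewrite !mulrA xu_comm.
Qed.

Lemma dirac_sqr (g := - (6%:R^-1 *: t)) (D := \sum_a x a * u a + g) :
  D ^+ 2 = 2%:R^-1 *: (\sum_a u a * u a) + g ^+ 2.
Proof.
(* The 3 of [cubic_anticomm] over the 6 in [g] is 1/2, so the cross terms are exactly opposite to
   the [q c * u c] term of [sum_xu_sqr]; this explains the normalization of gamma. *)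
have cross : (\sum_a x a * u a) * g + g * (\sum_a x a * u a)
    = - (2%:R^-1 *: \sum_c q c * u c).
  rewrite /g mulrN mulNr -opprD -pres_scalerAl -pres_scalerAr -scalerDr.
  rewrite mulr_suml mulr_sumr -big_split /=.
  have -> : \sum_c (x c * u c * t + t * (x c * u c))
      = 3%:R *: \sum_c q c * u c.
    rewrite scaler_sumr; apply: eq_bigr => c _.
    rewrite -mulrA -cubic_u_comm !mulrA -mulrDl cubic_anticomm.
    by rewrite -pres_scalerAl.
  by rewrite scalerA; congr (- (_ *: _)); field.
rewrite expr2 /D mulrDl !mulrDr sum_xu_sqr addrA -expr2; congr (_ + _).
by rewrite -!addrA cross subrr addr0.
Qed.

Lemma gamma_sqr (g := - (6%:R^-1 *: t)) :
  g ^+ 2 = - (48%:R^-1 * \sum_a \sum_b \sum_c f a b c * f a b c) *: (1 : A).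
Proof.
rewrite expr2 mulrNN -pres_scalerAl -pres_scalerAr cubic_sqr !scalerA.
congr (_ *: _); rewrite !mulrN !mulrA; congr (- (_ * _)).
(* The constant is (1/36)(3/4) = 1/48. *)
by field.
Qed.
End CubicElement.

(** * Symmetries of the structure constants in an orthonormal basis *)

Lemma lie_antisym (R : nzRingType) (g : lieAlgType R) (y z : g) :
  lie y z = - lie z y.
Proof.
have addE (v : g) : {morph (fun w => lie v w) : y z / y + z}.
  by move=> y' z'; rewrite -[y' in LHS]scale1r lie_linearr scale1r.
have addEl (v : g) : {morph (fun w => lie w v) : y z / y + z}.
  by move=> y' z'; rewrite -[y' in LHS]scale1r lie_linearl scale1r.
have := liexx (y + z); rewrite /= addE !addEl !liexx add0r addr0.
by move/eqP; rewrite addrC addr_eq0 => /eqP.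
Qed.

Section StructureConstants.
Variables (R : numDomainType) (g : lieAlgType R) (ip : {dot g for idfun}).
Hypothesis ip_inv : lie_invariant ip.
Variables (n : nat) (e : n.-tuple g) (f : 'I_n -> 'I_n -> 'I_n -> R).
Hypothesis e_orthonormal : forall a b : 'I_n,
  ip (tnth e a) (tnth e b) = (a == b)%:R.
Hypothesis f_struct : forall a b : 'I_n,
  lie (tnth e a) (tnth e b) = \sum_c f a b c *: tnth e c.

Lemma dotC (y z : g) : ip y z = ip z y.
Proof. by rewrite (hermC ip) expr0 mul1r. Qed.

Lemma dotZl k y z : ip (k *: y) z = k * ip y z.
Proof. exact: linearZl_LR. Qed.

Lemma dotDl y y' z : ip (y + y') z = ip y z + ip y' z.
Proof. exact: linearDl. Qed.

Lemma dotNl y z : ip (- y) z = - ip y z.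
Proof. exact: linearNl. Qed.

Lemma dot_suml (F : 'I_n -> g) z : ip (\sum_c F c) z = \sum_c ip (F c) z.
Proof. exact: linear_sumlz. Qed.

(** Lets the symmetries of [f] be read off from those of the bracket and the inner product. *)
Lemma dot_lie (a b c : 'I_n) :
  ip (lie (tnth e a) (tnth e b)) (tnth e c) = f a b c.
Proof.
rewrite f_struct dot_suml (bigD1 c) //= dotZl e_orthonormal eqxx.
rewrite mulr1 big1 ?addr0 // => d ne_dc.
by rewrite dotZl e_orthonormal (negbTE ne_dc) mulr0.
Qed.

Lemma structure_antisym12 a b c : f a b c = - f b a c.
Proof. by rewrite -!dot_lie lie_antisym dotNl. Qed.

Lemma structure_antisym23 a b c : f a b c = - f a c b.
Proof.
by rewrite -!dot_lie [in RHS]dotC; apply/eqP; rewrite -addr_eq0 ip_inv.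
Qed.

Lemma structure_jacobi a b d k :
  \sum_c f a b c * f d k c + \sum_c f b d c * f a k c
  + \sum_c f d a c * f b k c = 0.
Proof.
(* Invariance carries the bracket with [tnth e d'] across the inner product, so the three sums
   become the three terms of the Jacobi identity paired with [tnth e k]. *)
have contract a' b' d' : \sum_c f a' b' c * f d' k c
    = - ip (lie (tnth e d') (lie (tnth e a') (tnth e b'))) (tnth e k).
  have /eqP := ip_inv (tnth e d') (lie (tnth e a') (tnth e b')) (tnth e k).
  rewrite addrC addr_eq0 => /eqP <-; rewrite [X in ip X _]f_struct dot_suml.
  by apply: eq_bigr => c _; rewrite dotZl dotC dot_lie.
rewrite !contract -!opprD -!dotDl lie_jacobi.
by rewrite -(scale0r (tnth e k)) dotZl mul0r oppr0.
Qed.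
End StructureConstants.

(** * Relations between the two families of generators in the Weil algebra *)

Section WeilGenerators.
Variables (R : comNzRingType) (g : lieAlgType R) (ip : g -> g -> R).

HB.instance Definition _ := GRing.isLinear.Build R g (enveloping g) *:%R
  (@enveloping_gen R g) (@enveloping_gen_linear R g).
HB.instance Definition _ := GRing.isLinear.Build R (enveloping g) (weil ip)
  *:%R (weil_U ip) (tens_linearl 1).
HB.instance Definition _ := GRing.isLinear.Build R (clifford ip) (weil ip)
  *:%R (@weil_Cl R g ip) (tens_linearr 1).

Lemma weil_UM y z : weil_U ip (y * z) = weil_U ip y * weil_U ip z.
Proof. by rewrite /weil_U tensM mulr1. Qed.

Lemma weil_ClM (y z : clifford ip) : weil_Cl (y * z) = weil_Cl y * weil_Cl z.
Proof. by rewrite /weil_Cl tensM mulr1. Qed.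

Lemma weil_Cl_U_comm (y : clifford ip) z :
  weil_Cl y * weil_U ip z = weil_U ip z * weil_Cl y.
Proof. by rewrite /weil_Cl /weil_U !tensM !mul1r !mulr1. Qed.

Lemma weil_Cl_anticomm y z :
  weil_Cl (clifford_gen ip y) * weil_Cl (clifford_gen ip z)
  + weil_Cl (clifford_gen ip z) * weil_Cl (clifford_gen ip y)
  = ip y z *: (1 : weil ip).
Proof.
rewrite -!weil_ClM -linearD clifford_gen_anticomm linearZ /=.
by rewrite /weil_Cl tens1.
Qed.

Lemma weil_U_lie y z :
  weil_U ip (enveloping_gen y) * weil_U ip (enveloping_gen z)
  - weil_U ip (enveloping_gen z) * weil_U ip (enveloping_gen y)
  = weil_U ip (enveloping_gen (lie y z)).
Proof. by rewrite -!weil_UM -linearB enveloping_gen_lie. Qed.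

End WeilGenerators.

Lemma weil_Cl_gamma (R : fieldType) (g : lieAlgType R) (ip : g -> g -> R)
    (n : nat) (e : n.-tuple g) (f : 'I_n -> 'I_n -> 'I_n -> R)
    (x := fun a => weil_Cl (clifford_gen ip (tnth e a))) :
  weil_Cl (clifford_gamma ip e f)
  = - (6%:R^-1 *: \sum_a \sum_b \sum_c f a b c *: (x a * x b * x c)).
Proof.
rewrite /clifford_gamma linearN linearZ /= linear_sum; congr (- (_ *: _)).
apply: eq_bigr => a _; rewrite linear_sum; apply: eq_bigr => b _.
rewrite linear_sum; apply: eq_bigr => c _.
by rewrite linearZ /= !weil_ClM.
Qed.

Theorem proposition3p4 (R : realType) (g : lieAlgType R)
    (ip : {dot g for idfun}) (ip_inv : lie_invariant ip)
    (n : nat) (e : n.-tuple g) (e_basis : basis_of fullv e)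
    (e_orthonormal : forall a b : 'I_n,
       ip (tnth e a) (tnth e b) = (a == b)%:R)
    (f : 'I_n -> 'I_n -> 'I_n -> R)
    (f_struct : forall a b : 'I_n,
       lie (tnth e a) (tnth e b) = \sum_c f a b c *: tnth e c) :
  let u a := weil_U ip (enveloping_gen (tnth e a)) in
  let gamma := weil_Cl (clifford_gamma ip e f) in
  let D := weil_dirac ip e f in
  D ^+ 2 = 2%:R^-1 *: (\sum_a u a * u a) + gamma ^+ 2 /\
  2%:R^-1 *: (\sum_a u a * u a) + gamma ^+ 2
  = 2%:R^-1 *: (\sum_a u a * u a)
    - (48%:R^-1 * \sum_a \sum_b \sum_c f a b c * f a b c) *: (1 : weil ip).
Proof.
move=> u gamma D.
(* The Weil algebra is itself a presented algebra, so the section on the cubic element applies to it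
   directly, with both families of generators taken inside it. *)
pose x a := weil_Cl (clifford_gen ip (tnth e a)).
have x_anticomm a b : x a * x b + x b * x a = (a == b)%:R *: (1 : weil ip).
  by rewrite weil_Cl_anticomm e_orthonormal.
have xu_comm a b : x a * u b = u b * x a by exact: weil_Cl_U_comm.
have u_lie a b : u a * u b - u b * u a = \sum_c f a b c *: u c.
  rewrite weil_U_lie f_struct !linear_sum; apply: eq_bigr => c _.
  by rewrite !linearZ.
have f12 := structure_antisym12 e_orthonormal f_struct.
have f23 := structure_antisym23 ip_inv e_orthonormal f_struct.
have f_jacobi := structure_jacobi ip_inv e_orthonormal f_struct.
split.
  rewrite /D /gamma /weil_dirac weil_Cl_gamma.
  exact: (dirac_sqr x_anticomm f12 f23 xu_comm u_lie).
rewrite /gamma weil_Cl_gamma (gamma_sqr x_anticomm f12 f23 f_jacobi).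
by rewrite scaleNr.
Qed.
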